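(* Let $1\le k\le n$, $d\ge1$, let $x^0=(a,\zeta_2a,\dots,\zeta_na)\in\mathcal T$ with $a\in\mathbb{C}$ and $\zeta_2,\dots,\zeta_n\in\mu_r$ (put $\zeta_1:=1$), and let $1\le i\le n$. Set $\gamma_{k,n}:=(-1)^{k-1}(k-1)!/n^k$. 1. If $d<k$, then $\partial_{x_i}^dU_k(x^0)=0$. 2. If $d=k$, then $\partial_{x_i}^kU_k(x^0)=r^k\,(x_i^0)^{k(r-1)}\,\gamma_{k,n}$. In particular, this quantity vanishes at the origin ($a=0$) as soon as $r\ge2$, but is nonzero at every other point of $\mathcal T$ (where $x_i^0=\zeta_ia\ne0$). 3. If $d>k$, three regimes arise according to the sign of the exponent $kr-d$: (a) if $k<d<kr$ (so $kr-d\ge1$), then $\partial_{x_i}^dU_k(x^0)=\kappa_{d,k}\,(x_i^0)^{kr-d}\,\gamma_{k,n}$, which vanishes at the origin ($a=0$, since the exponent $kr-d$ is a strictly positive integer) but is generically nonzero elsewhere on $\mathcal T$; (b) if $d=kr$ (so $kr-d=0$), the same formula gives the constant $\partial_{x_i}^dU_k(x^0)=\kappa_{kr,k}\,\gamma_{k,n}$, independent of $x^0$ (in particular, not generally zero at the origin); (c) if $d>kr$, then $\kappa_{d,k}=0$ identically, so that $\partial_{x_i}^dU_k(x^0)=0$ at every point $x^0$ of $\mathcal T$; this vanishing follows directly from $\kappa_{d,k}=0$ and never requires forming the expression $(x_i^0)^{kr-d}$, whose exponent is here a negative integer, at $x_i^0=0$.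
   Context: Let $n,r\ge1$ be integers, $\mu_r$ the group of $r$-th roots of unity in $\mathbb{C}$, and $\mathcal T=\{x\in\mathbb{C}^n: x_1^r=\cdots=x_n^r\}$, every point of which has the form $(a,\zeta_2a,\dots,\zeta_na)$ with $a\in\mathbb{C}$, $\zeta_i\in\mu_r$. ''Generically nonzero'' on $\mathcal T$ means nonzero at all points of some dense open subset of $\mathcal T$. Let $E_h(x)=e_h(x_1^r,\dots,x_n^r)$ with $e_h$ the $h$-th elementary symmetric function, $\widetilde E_h=\frac{(n-h)!}{n!}E_h$, and for $1\le k\le n$ let $$U_k(x)=\sum_{\lambda\vdash k}(-1)^{l(\lambda)-1}\frac{(l(\lambda)-1)!}{\prod_{h=1}^km_h!}\prod_{h=1}^k\widetilde E_h(x)^{m_h},$$ the sum being over partitions $\lambda$ of $k$, with $l(\lambda)$ parts and multiplicities $m_h$ (the number of parts equal to $h$). The constants $\kappa_{d,j}$ ($1\le j\le d$) depend only on $d,j,r$ and are given by the recursion $\kappa_{1,1}=r$, $\kappa_{d+1,j}=(jr-d)\,\kappa_{d,j}+r\,\kappa_{d,j-1}$ for $1\le j\le d+1$, with $\kappa_{d,0}=\kappa_{d,d+1}=0$; they satisfy $\kappa_{d,j}=0$ whenever $jr<d$, and, for every one-variable holomorphic $\eta$, $\partial_x^d[\eta(x^r)]=\sum_{j=1}^d\kappa_{d,j}x^{jr-d}\eta^{(j)}(x^r)$ (terms with $jr<d$ being zero). The symbol $\partial_{x_i}$ is the ordinary partial derivative. Convention: $0^0=1$. *)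

(* Defs.v *)
From HB Require Import structures.
From mathcomp Require Import all_boot all_order all_algebra.
From mathcomp Require Import all_classical all_reals all_analysis.
From mathcomp Require Import complex.

Set Implicit Arguments.
Unset Strict Implicit.
Unset Printing Implicit Defensive.

Import Order.TTheory GRing.Theory Num.Theory numFieldNormedType.Exports.

Local Open Scope classical_set_scope.
Local Open Scope ring_scope.

(* Stated over any numeric field [K], whose canonical topology is the one of  *)
(* its norm; for [K := R[i]] with [R : realType] these are the notions over   *)
(* the complex numbers, and ['D_v] is the complex directional derivative.     *)
Section Definitions.
Context {K : numFieldType}.

Definition pderiven (n : nat) (i : 'I_n) (d : nat) (f : 'rV[K]_n -> K) :
    'rV[K]_n -> K :=
  iter d (fun g : 'rV[K]_n -> K => 'D_(delta_mx 0 i) g) f.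

Definition Tset (n r : nat) : set 'rV[K]_n :=
  [set x | forall j l : 'I_n, x 0 j ^+ r = x 0 l ^+ r].

(* [A `&` O], with [O] open in the ambient space, is the general form of a    *)
(* relatively open subset of [A].                                             *)
Definition generically_nonzero (n : nat) (A : set 'rV[K]_n)
    (f : 'rV[K]_n -> K) : Prop :=
  exists O : set 'rV[K]_n,
    [/\ open O, A `<=` closure (A `&` O)
      & forall x, (A `&` O) x -> f x != 0].

Definition elem_sym (n h : nat) (y : 'rV[K]_n) : K :=
  \sum_(A : {set 'I_n} | #|A| == h) \prod_(j in A) y 0 j.

Definition Epow (n r h : nat) (x : 'rV[K]_n) : K :=
  elem_sym h (\row_j (x 0 j ^+ r)).

Definition Etilde (n r h : nat) (x : 'rV[K]_n) : K :=
  ((n - h)`!%:R / n`!%:R) * Epow r h x.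

(* A partition of [k] is encoded by its multiplicities: [m h] is the number   *)
(* of parts equal to [h.+1], and no multiplicity exceeds [k].                 *)
Definition is_part_mult (k : nat) (m : {ffun 'I_k -> 'I_k.+1}) : bool :=
  (\sum_(h < k) h.+1 * m h == k)%N.

Definition part_length (k : nat) (m : {ffun 'I_k -> 'I_k.+1}) : nat :=
  (\sum_(h < k) m h)%N.

Definition U (n r k : nat) (x : 'rV[K]_n) : K :=
  \sum_(m : {ffun 'I_k -> 'I_k.+1} | is_part_mult m)
    (-1) ^+ (part_length m - 1)
    * ((part_length m - 1)`!%:R / (\prod_(h < k) (m h)`!)%N%:R)
    * \prod_(h < k) Etilde r h.+1 x ^+ m h.

Definition gamma_coef (k n : nat) : K :=
  (-1) ^+ (k - 1) * (k - 1)`!%:R / n%:R ^+ k.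

End Definitions.

Arguments Tset {K} n r _.

(* The value at [d = 0] is a filler: the recursion starts at [d = 1].         *)
Fixpoint kappa (r d j : nat) : int :=
  match d with
  | 0 => 0
  | d'.+1 =>
      if d' is 0 then (if j == 1%N then r%:Z else 0)
      else if (1 <= j <= d)%N then
        ((j * r)%:Z - d'%:Z) * kappa r d' j + r%:Z * kappa r d' j.-1
      else 0
  end.

(* Main.v *)
(* On the line through a point of T in the direction e_i, every x_j^r with    *)
(* j != i keeps its common value c, so with w = (x_i^r - c)/n one finds       *)
(* Etilde_h = c^h/h! + w c^(h-1)/(h-1)!, that is                              *)
(* 1 + sum_h Etilde_h z^h = e^(cz) (1 + wz). As U_k is the z^k-coefficient of *)
(* the logarithm of this series, U_k = [k = 1] c + (-1)^(k-1) w^k / k on the  *)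
(* line. At x_i^r = c the only nonzero derivative of positive order in x_i^r  *)
(* is the k-th, equal to gamma_{k,n}, and the chain rule for x |-> x^r brings *)
(* in the single factor kappa_{d,k} x_i^(kr-d).                               *)

Require Import Defs.
From HB Require Import structures.
From mathcomp Require Import all_boot all_order all_algebra.
From mathcomp Require Import all_classical all_reals all_analysis.
From mathcomp Require Import complex.
From mathcomp Require Import ring zify.

Set Implicit Arguments.
Unset Strict Implicit.
Unset Printing Implicit Defensive.

Import Order.TTheory GRing.Theory Num.Theory numFieldNormedType.Exports.

Local Open Scope ring_scope.

(** Every case of the theorem is read off one formula, [pderiven_U]: on T the d-th derivative is
    kappa_{d,k} x_i^(kr-d) gamma_{k,n}, with truncated exponent. The zeros and signs of kappa decide
    the rest: it vanishes for d < k ([kappa_out]) and for d > kr ([kappa_small]), equals r^k at d =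
    k ([kappa_diag]), and is positive for k <= d <= kr ([kappa_gt0]).

    The formula is purely algebraic up to its last step. [sum_part_mult_log] reads the partition sum
    as a coefficient of a logarithm, [coef_log_exp_linear] computes that coefficient, and [U_line]
    thereby makes U_k a polynomial in x_i along a coordinate line. [pderiven_line_poly] then
    replaces iterated partial derivatives by formal derivatives, and [horner_derivn_XsubC_comp_Xn]
    evaluates these. *)

(** * The coefficients kappa and the chain rule for x^r *)

Lemma kappa_out (r d j : nat) : ~~ (0 < j <= d)%N -> kappa r d j = 0.
Proof.
case: d => [|[|d]] //= hj; last by rewrite (negbTE hj).
by case: eqP hj => // ->.
Qed.

Lemma kappaS (r d j : nat) : (0 < d)%N ->
  kappa r d.+1 j = ((j * r)%:Z - d%:Z) * kappa r d j + r%:Z * kappa r d j.-1.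
Proof.
case: d => // d _; have [jd|jd] := boolP (0 < j <= d.+2)%N.
  by rewrite [in LHS]/kappa -/kappa jd.
by rewrite !kappa_out ?mulr0 ?addr0 //; lia.
Qed.

Lemma kappa_diag (r d : nat) : (0 < d)%N -> kappa r d d = (r ^ d)%N.
Proof.
elim: d => // d IH _; have [->|d0] := posnP d; first by rewrite /= expn1.
rewrite kappaS // (kappa_out _ (j := d.+1)) ?ltnn //.
by rewrite mulr0 add0r IH // -PoszM expnS.
Qed.

(** In the recursion from d to d+1 the term in j-1 vanishes by induction. The term in j does too if
    jr < d; in the remaining case jr = d its factor jr - d is zero. *)
Lemma kappa_small (r d j : nat) : (j * r < d)%N -> kappa r d j = 0.
Proof.
elim: d j => // d IH [|j] hj; first by rewrite kappa_out.
have [d0|d0] := posnP d.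
  by rewrite d0 /=; case: j hj => // /[!(d0, mul1n, ltnS, leqn0)] /eqP ->.
have [jd|jd] := leqP j d; last by rewrite kappa_out //; lia.
rewrite kappaS //= (IH j); last by nia.
rewrite mulr0 addr0.
have [jr|jr] := ltnP (j.+1 * r) d; first by rewrite IH // mulr0.
by rewrite (_ : (j.+1 * r)%N = d) ?subrr ?mul0r //; lia.
Qed.

(** For j <= d+1 <= jr the factor jr - d is positive, so the recursion adds nonnegative terms. The
    first is positive if j <= d; if j = d+1 the second is. All nonvanishing claims rest on this. *)
Lemma kappa_gt0 (r d j : nat) :
  (0 < r)%N -> (0 < j)%N -> (j <= d <= j * r)%N -> 0 < kappa r d j.
Proof.
move=> r0; elim: d j => [|d IH] j j0 /andP[jd djr]; first by lia.
have [d0|d0] := posnP d; first by rewrite d0 /= (_ : j == 1%N) //; lia.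
have kge0 l : (l <= d)%N -> 0 <= kappa r d l.
  move=> ld; have [l0|l0] := posnP l; first by rewrite kappa_out ?l0.
  have [lr|lr] := ltnP (l * r) d; first by rewrite kappa_small.
  by rewrite ltW // IH // ld.
rewrite kappaS //; have [jd'|jd'] := leqP j d.
  apply: ltr_wpDr; first by rewrite mulr_ge0 // kge0; lia.
  by rewrite mulr_gt0 ?IH //; lia.
have {jd jd'} -> : j = d.+1 by lia.
rewrite (kappa_out _ (j := d.+1)) ?ltnn //.
by rewrite mulr0 add0r mulr_gt0 //= IH //; nia.
Qed.

(* The subtraction [j * r - d] is truncated, harmlessly: [kappa r d j = 0]    *)
(* when [j * r < d].                                                          *)
Lemma derivn_comp_Xn (A : comNzRingType) (p : {poly A}) (r d : nat) :
  (0 < r)%N -> (0 < d)%N ->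
  (p \Po 'X^r)^`(d) =
  \sum_(j < d.+1) ((p^`(j) \Po 'X^r) * 'X^(j * r - d)) *~ kappa r d j.
Proof.
move=> r0; elim: d => // d IH _.
have [->|d0] := posnP d.
  rewrite big_ord_recl big_ord1 /= mulr0z add0r deriv_comp derivXn mul1n subn1.
  by rewrite -pmulrn mulrnAr.
rewrite derivnS IH // raddf_sum.
under [RHS]eq_bigr do rewrite kappaS // mulrzDr.
pose F j := (p^`(j) \Po 'X^r) * 'X^(j * r - d.+1).
(* Differentiating the j-th term contributes jr - d to [F j] and r to [F j.+1]; collecting by index
   gives the recursion of [kappa]. *)
transitivity (\sum_(j < d.+1) (F j *~ (((j * r)%:Z - d%:Z) * kappa r d j)
                             + F j.+1 *~ (r%:Z * kappa r d j))).
  apply: eq_bigr => j _; rewrite raddfMz /=.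
  have [jd|dj] := ltnP (j * r) d.
    by rewrite kappa_small // !mulr0 !mulr0z addr0.
  rewrite !mulrzA -mulrzDl; congr (_ *~ _).
  rewrite subzn // derivM deriv_comp !derivXn /F derivnS.
  have -> : (j.+1 * r - d.+1 = (j * r - d) + r.-1)%N by lia.
  rewrite exprD subnS -!pmulrn !mulrnAr mulrnAl [RHS]addrC; congr (_ *+ _ + _).
  by rewrite -mulrA [_ * 'X^(r.-1)]mulrC.
rewrite big_split /=.
rewrite big_split /=; congr (_ + _).
  rewrite [RHS]big_ord_recr /= kappa_out ?mulr0 ?mulr0z ?addr0 //.
  by rewrite ltnn.
by rewrite [RHS]big_ord_recl /= (@kappa_out _ _ 0) // mulr0 mulr0z add0r.
Qed.

(** * Partition sums as coefficients of a logarithm *)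

(** Up to degree N the factors agree with the series e^(b_h z), whose product is the exponential of
    the sum; the binomial theorem checks this for two factors. *)
Lemma coef_prod_trunc_exp (F : numFieldType) (A : comAlgType F) (I : finType)
    (b : I -> A) (N l : nat) : (l <= N)%N ->
  (\prod_h \poly_(j < N.+1) (j`!%:R^-1 *: b h ^+ j))`_l
  = l`!%:R^-1 *: (\sum_h b h) ^+ l.
Proof.
move: l; pose rel (P : {poly A}) (x : A) :=
  forall l, (l <= N)%N -> P`_l = l`!%:R^-1 *: x ^+ l.
apply: (big_ind2 rel) => [l _|P x Q y hP hQ l lN|h _ l lN].
- by rewrite coef1 expr0n; case: l => [|l]; rewrite ?invr1 ?scale1r ?scaler0.
- rewrite coefMr exprDn scaler_sumr; apply: eq_bigr => -[j /= jl] _.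
  rewrite hP ?hQ; try lia.
  rewrite -scalerAl -scalerAr scalerA -(scaler_nat (R := F) 'C(l, j)) scalerA.
  congr (_ *: _).
  rewrite -(bin_fact (n := l) (m := j)); last by lia.
  have hC : 'C(l, j)%:R != 0 :> F by rewrite pnatr_eq0 -lt0n bin_gt0; lia.
  have hf i : i`!%:R != 0 :> F by rewrite pnatr_eq0 -lt0n fact_gt0.
  have h1 := hf j; have h2 := hf (l - j)%N.
  by rewrite !natrM; field; rewrite h1 h2 hC.
- by rewrite coef_poly ltnS lN.
Qed.

(** The multinomial theorem, indexed by bounded multiplicity functions to match the encoding of
    partitions: expand the product of truncated exponentials and compare coefficients of degree
    l. *)
Lemma multinomial_ffun (F : numFieldType) (A : comAlgType F) (I : finType)
    (b : I -> A) (N l : nat) : (l <= N)%N ->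
  \sum_(m : {ffun I -> 'I_N.+1} | (\sum_h m h)%N == l)
     ((\prod_h (m h)`!)%N)%:R^-1 *: \prod_h b h ^+ m h
  = l`!%:R^-1 *: (\sum_h b h) ^+ l.
Proof.
move=> lN; rewrite -(coef_prod_trunc_exp b lN).
under [in RHS]eq_bigr do rewrite poly_def.
rewrite bigA_distr_bigA coef_sum big_mkcond; apply: eq_bigr => m _ /=.
under [in RHS]eq_bigr do rewrite -mul_polyC.
rewrite big_split prodrXr -rmorph_prod /= coefCM coefXn eq_sym.
case: eqP => _; rewrite ?mulr1 ?mulr0 //.
by rewrite scaler_prod prodfV natr_prod.
Qed.

(** The right side is the z^k-coefficient of log(1 + A) with A the sum of the a_h z^(h+1), as powers
    of A beyond the k-th start above z^k. Partitions are grouped by length l+1; the multinomial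
    theorem expands A^(l+1), and its z^k-coefficient selects the multiplicities of weight k. *)
Lemma sum_part_mult_log (F : numFieldType) (k : nat) (a : 'I_k -> F) :
  (0 < k)%N ->
  \sum_(m : {ffun 'I_k -> 'I_k.+1} | is_part_mult m)
    (-1) ^+ (part_length m - 1)
    * ((part_length m - 1)`!%:R / (\prod_(h < k) (m h)`!)%N%:R)
    * \prod_(h < k) a h ^+ m h
  = \sum_(l < k) (-1) ^+ l / l.+1%:R
      * ((\sum_(h < k) a h *: 'X^(h.+1)) ^+ l.+1)`_k.
Proof.
move=> k0; pose G (m : {ffun 'I_k -> 'I_k.+1}) :=
    (-1) ^+ (part_length m - 1)
    * ((part_length m - 1)`!%:R / (\prod_(h < k) (m h)`!)%N%:R)
    * \prod_(h < k) a h ^+ m h.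
transitivity
  (\sum_(l < k) \sum_(m | is_part_mult m && (part_length m == l.+1)) G m).
  under [RHS]eq_bigr do rewrite big_mkcondr.
  rewrite exchange_big /=; apply: eq_bigr => m /eqP wm.
  have lk : (part_length m <= k)%N.
    by rewrite -[leqRHS]wm; apply: leq_sum => h _; rewrite leq_pmull.
  have l0 : (0 < part_length m)%N.
    rewrite lt0n; apply: contraTneq k0 => /eqP.
    rewrite sum_nat_eq0 => /forallP m0.
    rewrite -leqNgt -[leqLHS]wm big1 // => h _.
    by rewrite (eqP (m0 h)) muln0.
  have lt : (part_length m - 1 < k)%N by lia.
  rewrite -big_mkcond [RHS](big_pred1 (Ordinal lt)) // => l.
  by apply/eqP/eqP => [pl|->]; [apply: val_inj|]; rewrite /=; lia.
apply: eq_bigr => l _.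
pose B := \sum_(h < k) a h *: 'X^(h.+1).
have -> : (-1) ^+ l / l.+1%:R * (B ^+ l.+1)`_k
        = (-1) ^+ l * l`!%:R * (l.+1`!%:R^-1 *: B ^+ l.+1)`_k.
  rewrite coefZ factS natrM.
  have h1 : l`!%:R != 0 :> F by rewrite pnatr_eq0 -lt0n fact_gt0.
  by field; rewrite h1 nat1r pnatr_eq0.
rewrite -(multinomial_ffun _ (N := k)) // coef_sum mulr_sumr.
rewrite big_mkcondl; apply: eq_bigr => m /eqP ml.
have -> : \prod_(h < k) (a h *: 'X^(h.+1)) ^+ m h
  = (\prod_(h < k) a h ^+ m h) *: 'X^(\sum_(h < k) h.+1 * m h) :> {poly F}.
  rewrite -prodrXr -scaler_prod; apply: eq_bigr => h _.
  by rewrite exprZn -exprM.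
rewrite !coefZ coefXn eq_sym /is_part_mult.
case: eqP => _; last by rewrite !mulr0.
by rewrite /G (ml : part_length m = _) subn1 /= !mulrA mulr1.
Qed.

(** The inner sum agrees up to z^k with e^(cz) (1 + wz) - 1, and the logarithm of e^(cz) (1 + wz) is
    cz + log(1 + wz). The proof compares logarithmic derivatives of truncated polynomials. *)
Lemma coef_log_exp_linear (F : numFieldType) (c w : F) (k : nat) :
  (0 < k)%N ->
  \sum_(l < k) (-1) ^+ l / l.+1%:R
   * ((\sum_(h < k) (c ^+ h.+1 / h.+1`!%:R + w * (c ^+ h / h`!%:R))
        *: 'X^(h.+1)) ^+ l.+1)`_k
  = (if k == 1%N then c else 0) + (-1) ^+ (k - 1) * w ^+ k / k%:R.
Proof.
case: k => // k _.
pose A : {poly F} :=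
  \sum_(h < k.+1) (c ^+ h.+1 / h.+1`!%:R + w * (c ^+ h / h`!%:R)) *: 'X^(h.+1).
rewrite -/A.
pose e : {poly F} := \sum_(h < k.+1) (c ^+ h / h`!%:R) *: 'X^h.
pose ek := c ^+ k.+1 / k.+1`!%:R.
have k0 : k.+1%:R != 0 :> F by rewrite pnatr_eq0.
(* All computations are modulo ['X^(k.+1)]: there [e] is e^(cz), [1 + A] is   *)
(* e^(cz) (1 + wz), [S] is its inverse, [G] is the inverse of [1 + wz], and   *)
(* the log-derivative [A^`() * S] is [c + w G].                               *)
have AE : A = e + ek *: 'X^(k.+1) - 1 + w *: 'X * e.
  have -> : e + ek *: 'X^(k.+1) = \sum_(h < k.+2) (c ^+ h / h`!%:R) *: 'X^h.
    by rewrite [RHS]big_ord_recr.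
  rewrite big_ord_recl /= expr0 divr1 scale1r [1 + _]addrC addrK.
  rewrite /A /e mulr_sumr -big_split /=; apply: eq_bigr => h _.
  rewrite /bump leq0n add1n; set u := _ / _; set v := c ^+ h / _.
  rewrite scalerDl -[in RHS]scalerAr -[in RHS]scalerAl -exprS scalerA.
  by rewrite [v * w]mulrC.
have eE : e^`() = c *: e - (ek *+ k.+1) *: 'X^k.
  apply/eqP; rewrite -subr_eq opprK; apply/eqP.
  transitivity ((\sum_(h < k.+2) (c ^+ h / h`!%:R) *: 'X^h)^`() : {poly F}).
    rewrite [in RHS]big_ord_recr /= derivD derivZ derivXn /=.
    by rewrite -scalerMnl -scalerMnr.
  rewrite big_ord_recl /= derivD expr0 divr1 scale1r derivC add0r raddf_sum.
  rewrite scaler_sumr; apply: eq_bigr => h _.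
  rewrite /= /bump leq0n add1n derivZ derivXn /= -(scaler_nat _ 'X^h) !scalerA.
  rewrite exprS factS natrM; congr (_ *: _).
  have h1 : h`!%:R != 0 :> F by rewrite pnatr_eq0 -lt0n fact_gt0.
  by field; rewrite h1 nat1r pnatr_eq0.
pose S : {poly F} := \sum_(l < k.+1) (- A) ^+ l.
pose G : {poly F} := \sum_(j < k.+1) (- (w *: 'X)) ^+ j.
pose B : {poly F} :=
  \sum_(h < k.+1) (c ^+ h.+1 / h.+1`!%:R + w * (c ^+ h / h`!%:R)) *: 'X^h.
have AB : A = 'X * B.
  rewrite /A /B mulr_sumr; apply: eq_bigr => h _.
  by rewrite -[in RHS]scalerAr -exprS.
have hS : (1 + A) * S = 1 - (- B) ^+ k.+1 * 'X^(k.+1).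
  have := subrX1 (- A) k.+1; rewrite -/S AB -mulrN exprMn => h.
  apply: oppr_inj; rewrite -mulNr opprD [- 1 - _]addrC -mulrN -h; ring.
have hG : (1 + w *: 'X) * G = 1 - ((- w) ^+ k.+1)%:P * 'X^(k.+1).
  have <- : (- (w *: 'X)) ^+ k.+1 = ((- w) ^+ k.+1)%:P * 'X^(k.+1).
    by rewrite -scaleNr exprZn mul_polyC.
  by apply: oppr_inj; rewrite opprB subrX1 -/G -mulNr opprD [- 1 - _]addrC.
have [R hR] : exists R, A^`() * S = c%:P + w *: G + R * 'X^(k.+1).
  pose W := w *: 'X : {poly F}; pose Y := 'X^(k.+1) : {poly F}.
  pose b := (- B) ^+ k.+1; pose g := ((- w) ^+ k.+1)%:P.
  have dA : A^`() = (c%:P * (1 + W) + w%:P) * e - w%:P * (ek *+ k.+1)%:P * Y.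
    rewrite AE !(derivD, derivM, derivZ, derivC, derivX, derivN, derivXn) eE /=.
    rewrite /W /Y -!mul_polyC exprS polyCMn -mulr_natr -[in RHS]mulr_natr; ring.
  have eS1 : (1 + W) * (e * S) = 1 - b * Y - ek%:P * Y * S.
    rewrite -hS AE /W /Y -!mul_polyC; ring.
  (* Multiplying [eS1] by [G] cancels 1 + wX up to the error [g * Y] from [hG]. *)
  have eS : e * S = G - G * b * Y - G * ek%:P * Y * S + g * Y * (e * S).
    transitivity (G * ((1 + W) * (e * S)) + g * Y * (e * S)); last first.
      by rewrite eS1; ring.
    by rewrite mulrA [G * _]mulrC hG -/Y -/g; ring.
  exists (w%:P * (g * (e * S) - G * b - G * ek%:P * S)
          - c%:P * (b + ek%:P * S) - w%:P * (ek *+ k.+1)%:P * S).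
  rewrite dA -/Y -mul_polyC.
  transitivity (c%:P * ((1 + W) * (e * S)) + w%:P * (e * S)
    - w%:P * (ek *+ k.+1)%:P * Y * S); first ring.
  by rewrite eS1 [in w%:P * (e * S)]eS; ring.
have Gk : G`_k = (- w) ^+ k.
  rewrite (_ : G = \poly_(j < k.+1) (- w) ^+ j) ?coef_poly ?leqnn //.
  by rewrite poly_def; apply: eq_bigr => j _; rewrite -scaleNr exprZn.
(* The factor k+1 turns the coefficient of degree k+1 into the coefficient of degree k of the
   derivative. *)
apply: (mulIf k0).
transitivity (A^`() * S)`_k; last first.
  rewrite hR !coefD coefC coefZ Gk coefMXn leqnn addr0 subn1 /= eqSS.
  rewrite mulrDl mulfVK // [(- w) ^+ k]exprNn exprS mulrCA; congr (_ + _).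
  by case: (k == 0%N) /eqP => [->|_]; rewrite ?mulr1 ?mul0r.
rewrite /S mulr_sumr coef_sum mulr_suml; apply: eq_bigr => l _.
rewrite -[LHS]mulrA.
have -> : (A ^+ l.+1)`_k.+1 * k.+1%:R = l.+1%:R * (A^`() * A ^+ l)`_k.
  by rewrite mulr_natr -coef_deriv deriv_exp /= coefMn mulr_natl.
have l0 : l.+1%:R != 0 :> F by rewrite pnatr_eq0.
rewrite mulrA mulfVK // [(- A) ^+ l]exprNn mulrCA -signr_odd -[in RHS]signr_odd.
by case: odd; rewrite ?expr1 ?mulN1r ?coefN // !expr0 !mul1r.
Qed.

(** * Formal derivatives at the base point *)

Lemma derivn_XsubC_exp (A : comNzRingType) (c : A) (k j : nat) :
  (('X - c%:P) ^+ k)^`(j) = ('X - c%:P) ^+ (k - j) *+ k ^_ j.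
Proof.
elim: j => [|j IH]; first by rewrite subn0 ffactn0.
rewrite derivnS IH derivMn deriv_exp derivB derivX derivC subr0 mul1r.
by rewrite -mulrnA mulnC -ffactnSr -subnS.
Qed.

(** At s^r = c every derivative of (X - c)^k except the k-th vanishes, so the chain rule keeps only
    j = k. *)
Lemma horner_derivn_XsubC_comp_Xn (K : fieldType) (u g c s : K) (r k d : nat) :
  (0 < r)%N -> (0 < k)%N -> (0 < d)%N -> s ^+ r = c ->
  ((u%:P + g *: ('X - c%:P) ^+ k) \Po 'X^r)^`(d).[s]
  = (kappa r d k)%:~R * s ^+ (k * r - d) * (g * k`!%:R).
Proof.
move=> r0 k0 d0 sc; rewrite derivn_comp_Xn // horner_sum.
have term (j : nat) : (0 < j)%N ->
  ((((u%:P + g *: ('X - c%:P) ^+ k)^`(j) \Po 'X^r) * 'X^(j * r - d))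
    *~ kappa r d j).[s]
  = if j == k then (kappa r d k)%:~R * s ^+ (k * r - d) * (g * k`!%:R) else 0.
  move=> j0; rewrite -horner_evalE raddfMz /= horner_evalE hornerM horner_comp.
  rewrite !hornerXn sc derivnD derivnC eqn0Ngt j0 add0r derivnZ.
  rewrite derivn_XsubC_exp hornerZ hornerMn horner_exp !hornerE subrr expr0n subn_eq0.
  have [kj|jk|->] := ltngtP j k; rewrite ?mul0rn ?mulr0 ?mul0r ?mul0rz //.
    by rewrite ffact_small // mulr0 mul0r mul0rz.
  by rewrite ffactnn -mulrzr /=; ring.
(* For d < k the index j = k lies outside the sum, and the right side is zero because kappa_{d,k}
   is. *)
have [kd|dk] := leqP k d; last first.
  rewrite kappa_out ?mul0r; last by lia.
  apply: big1 => -[[|j] jd] _ /=.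
    by rewrite kappa_out // mulr0z horner0.
  by rewrite term // ltn_eqF //; lia.
rewrite (bigD1 (Ordinal (kd : (k < d.+1)%N))) //= term // eqxx big1 ?addr0 //.
move=> [[|j] jd] /=; first by rewrite kappa_out // mulr0z horner0.
by rewrite -val_eqE /= term // => /negbTE ->.
Qed.

(** * Symmetric functions along a coordinate line *)

Lemma card_draws_mem (T : finType) (i : T) (h : nat) :
  #|[set A : {set T} | (#|A| == h.+1) && (i \in A)]| = 'C(#|T|.-1, h).
Proof.
have := card_draws T h.+1.
rewrite -(cardsID [set A : {set T} | i \in A]).
have -> : [set A : {set T} | #|A| == h.+1] :\: [set A : {set T} | i \in A]
  = [set A : {set T} | (A \subset [set~ i]) & (#|A| == h.+1)].
  by apply/setP => A; rewrite !inE -finset.setTD finset.subsetD1 finset.subsetT.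
rewrite cards_draws cardsC1 -finset.setIdE.
have : (0 < #|T|)%N by apply/card_gt0P; exists i.
case: #|T| => // t _ /=; rewrite binS addnC => /addnI <-.
by apply: eq_card => A; rewrite !inE.
Qed.

(** Each (h+1)-subset contributes c^(h+1), corrected by (y_i - c) c^h when it contains i. *)
Lemma elem_sym_line (K : numFieldType) (n h : nat) (y : 'rV[K]_n) (c : K)
    (i : 'I_n) : (forall j, j != i -> y 0 j = c) ->
  elem_sym h.+1 y = 'C(n, h.+1)%:R * c ^+ h.+1
    + 'C(n.-1, h)%:R * ((y 0 i - c) * c ^+ h).
Proof.
move=> yc; rewrite /elem_sym.
transitivity (\sum_(A in [set A : {set 'I_n} | #|A| == h.+1]) c ^+ h.+1
  + \sum_(A in [set A : {set 'I_n} | (#|A| == h.+1) && (i \in A)])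
      ((y 0 i - c) * c ^+ h)); last first.
  by rewrite !sumr_const card_draws card_draws_mem card_ord !mulr_natl.
rewrite [X in _ = _ + X](eq_bigl
    (fun A : {set 'I_n} => (#|A| == h.+1) && (i \in A))); last first.
  by move=> A; rewrite inE.
rewrite [X in _ = X + _](eq_bigl (fun A : {set 'I_n} => #|A| == h.+1));
  last by move=> A; rewrite inE.
rewrite [X in _ = _ + X]big_mkcondr -big_split; apply: eq_bigr => A /eqP cA /=.
have [iA|iA] := boolP (i \in A); last first.
  rewrite addr0 -cA -prodr_const; apply: eq_bigr => j jA.
  by rewrite yc //; apply: contraNneq iA => <-.
rewrite (big_setD1 i) //= (eq_bigr (fun=> c)); last first.
  by move=> j /[!inE] /andP[ji _]; exact: yc.
have -> : \prod_(j in A :\ i) c = c ^+ h.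
  rewrite prodr_const; congr (_ ^+ _).
  by move: cA; rewrite (cardsD1 i) iA => -[].
by rewrite exprS; ring.
Qed.

(** The normalisation of [Etilde] turns the binomial coefficients into inverse factorials, which is
    where the exponential series comes from. *)
Lemma Etilde_line (K : numFieldType) (n r h : nat) (x : 'rV[K]_n) (c : K)
    (i : 'I_n) : (h < n)%N -> (forall j, j != i -> x 0 j ^+ r = c) ->
  Etilde r h.+1 x
  = c ^+ h.+1 / h.+1`!%:R + (x 0 i ^+ r - c) / n%:R * (c ^+ h / h`!%:R).
Proof.
move=> hn xc; rewrite /Etilde /Epow (@elem_sym_line _ _ _ _ c i); last first.
  by move=> j ji; rewrite mxE xc.
rewrite mxE.
have hf l : l`!%:R != 0 :> K by rewrite pnatr_eq0 -lt0n fact_gt0.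
have n0 : n%:R != 0 :> K by rewrite pnatr_eq0; lia.
have binE m l : (l <= m)%N ->
    'C(m, l)%:R = m`!%:R / (l`!%:R * (m - l)`!%:R) :> K.
  move=> lm; apply: (canRL (mulfK _)); first exact: mulf_neq0.
  by rewrite -!natrM bin_fact.
have e3 : n`!%:R = n%:R * n.-1`!%:R :> K.
  by rewrite -natrM; congr (_%:R); case: (n) hn => // m _; rewrite factS.
rewrite !binE //; last by lia.
rewrite (_ : (n.-1 - h = n - h.+1)%N); last by lia.
have := hf n.-1; have := hf (n - h.+1)%N; have := hf h; have := hf h.+1.
rewrite e3; move: (h.+1`!%:R : K) (h`!%:R : K).
move: ((n - h.+1)`!%:R : K) (n.-1`!%:R : K).
move: (n%:R : K) n0 => m m0 t v p q p0 q0 t0 v0.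
by field; rewrite v0 t0 p0 q0 m0.
Qed.

(** The coordinate i stays free, so the formula holds along the whole line and can be
    differentiated. *)
Lemma U_line (K : numFieldType) (n r k : nat) (x : 'rV[K]_n) (c : K)
    (i : 'I_n) : (0 < k <= n)%N -> (forall j, j != i -> x 0 j ^+ r = c) ->
  U r k x = (if k == 1%N then c else 0)
    + (-1) ^+ (k - 1) * ((x 0 i ^+ r - c) / n%:R) ^+ k / k%:R.
Proof.
move=> /andP[k0 kn] xc; rewrite -coef_log_exp_linear // -sum_part_mult_log //.
apply: eq_bigr => m _; congr (_ * _); apply: eq_bigr => h _.
by rewrite (Etilde_line _ xc) //; apply: leq_trans kn.
Qed.

Local Open Scope classical_set_scope.

(** * From partial derivatives to formal derivatives *)

Lemma is_derive_horner (K : numFieldType) (p : {poly K}) (x : K) :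
  is_derive x (1 : K) (horner p) p^`().[x].
Proof.
elim/poly_ind: p => [|p c ih].
  rewrite (_ : horner 0 = cst 0); last by apply/funext => y; rewrite horner0.
  by rewrite deriv0 horner0; exact: is_derive_cst.
rewrite (_ : horner _ = horner p * id + cst c); last first.
  by apply/funext => y; rewrite !hornerE.
apply: is_derive_eq.
rewrite derivMXaddC hornerD hornerM hornerX addr0 addrC.
by rewrite /GRing.scale /= mulr1 mulrC addrC.
Qed.

(** The difference quotient of [f] along [v] is literally that of p(X + c) at 0, so both limits are
    the same expression. *)
Lemma derive_line_poly (K : numFieldType) (V : normedModType K)
    (f : V -> K) (p : {poly K}) (x v : V) (c : K) :
  (forall t, f (x + t *: v) = p.[c + t]) -> 'D_v f x = p^`().[c].
Proof.
move=> fp.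
have -> : 'D_v f x = 'D_1 (horner (p \Po ('X + c%:P))) 0.
  apply: (congr1 (fun g => lim (g @ 0^'))); apply/funext => h /=.
  rewrite [h *: v + x]addrC fp -[in f x](addr0 x) -(scale0r v) fp.
  by rewrite !horner_comp !hornerE [h%:A]mulr1 [h + c]addrC.
rewrite (@derive_val _ _ _ _ _ _ _ (is_derive_horner (p \Po ('X + c%:P)) 0)).
by rewrite deriv_comp derivD derivX derivC addr0 mulr1 horner_comp !hornerE.
Qed.

Lemma pderiven_line_poly (K : numFieldType) (n : nat) (i : 'I_n) (d : nat)
    (f : 'rV[K]_n -> K) (p : {poly K}) (x : 'rV[K]_n) :
  (forall t, f (x + t *: delta_mx 0 i) = p.[x 0 i + t]) ->
  pderiven i d f x = p^`(d).[x 0 i].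
Proof.
move=> fp.
(* The induction needs the equality on the whole line, since the next derivative uses neighbouring
   values. *)
suff H t : pderiven i d f (x + t *: delta_mx 0 i) = p^`(d).[x 0 i + t].
  by have := H 0; rewrite scale0r !addr0.
elim: d t => [|d IH] t //=.
apply: (@derive_line_poly K _ (pderiven i d f) p^`(d)) => s.
by rewrite -!addrA -scalerDl IH.
Qed.

Lemma pderiven_U (K : numFieldType) (n r k d : nat) (i : 'I_n) (x : 'rV[K]_n) :
  (0 < r)%N -> (0 < k <= n)%N -> (0 < d)%N -> Tset n r x ->
  pderiven i d (U r k) x
  = (kappa r d k)%:~R * x 0 i ^+ (k * r - d) * gamma_coef k n.
Proof.
move=> r0 /[dup] /andP[k0 kn] hk d0 Tx; pose c := x 0 i ^+ r.
(* The coefficient of (x_i^r - c)^k in [U_line]; k! times it is [gamma_coef k n]. *)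
pose g : K := (-1) ^+ (k - 1) / n%:R ^+ k / k%:R.
rewrite (@pderiven_line_poly _ _ _ _ _
  (((if k == 1%N then c else 0)%:P + g *: ('X - c%:P) ^+ k) \Po 'X^r));
  last first.
  move=> t; rewrite (@U_line _ _ _ _ _ c i) //; last first.
    by move=> j ji; rewrite !mxE eqxx (negbTE ji) mulr0 addr0; exact: Tx.
  rewrite !mxE !eqxx mulr1 horner_comp !hornerE expr_div_n.
  by congr (_ + _); rewrite /g; ring.
rewrite horner_derivn_XsubC_comp_Xn //; congr (_ * _).
have kE : k`!%:R = k%:R * (k - 1)`!%:R :> K.
  by rewrite -natrM; congr (_%:R); case: (k) k0 => // m _; rewrite factS subn1.
have k1 : k%:R != 0 :> K by rewrite pnatr_eq0; lia.
by rewrite /g /gamma_coef kE mulrA divfK // mulrAC.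
Qed.

(** * Nonvanishing and genericity on T *)

Lemma gamma_coef_neq0 (K : numFieldType) (k n : nat) :
  (0 < n)%N -> gamma_coef k n != 0 :> K.
Proof.
move=> n0; apply: mulf_neq0; first apply: mulf_neq0; first by rewrite signr_eq0.
  by rewrite pnatr_eq0 -lt0n fact_gt0.
by rewrite invr_eq0 expf_neq0 // pnatr_eq0 -lt0n.
Qed.

Lemma Tset_coord_neq0 (K : numFieldType) (n r : nat) (x : 'rV[K]_n) (i : 'I_n) :
  (0 < r)%N -> Tset n r x -> x != 0 -> x 0 i != 0.
Proof.
move=> r0 Tx; apply: contraNneq => xi0; apply/eqP/rowP => j; rewrite mxE.
have /eqP := Tx j i; rewrite xi0 expr0n eqn0Ngt r0 expf_eq0 => /andP[_ /eqP].
exact.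
Qed.

Lemma open_coord_neq0 (K : numFieldType) (n : nat) (i : 'I_n) :
  open [set x : 'rV[K]_n | x 0 i != 0].
Proof.
rewrite (_ : mkset _ = (fun x : 'rV[K]_n => x 0 i) @^-1` (~` [set 0])).
  apply: open_comp => [x _|]; first exact: coord_continuous.
  apply/closed_openC/accessible_closed_set1/hausdorff_accessible.
  exact: norm_hausdorff.
by apply/seteqP; split=> x /= /eqP.
Qed.

(** The origin is the only point of T with x_i = 0, and small nonzero constant vectors of T approach
    it. *)
Lemma Tset_sub_closure (K : numFieldType) (n r : nat) (i : 'I_n) :
  (0 < r)%N ->
  Tset n r `<=` closure (Tset n r `&` [set x : 'rV[K]_n | x 0 i != 0]).
Proof.
move=> r0 x Tx.
have [->|x0] := eqVneq x 0; last first.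
  by apply: subset_closure; split => //; exact: (Tset_coord_neq0 i r0 Tx x0).
move=> B /nbhs_ballP[e /= e0 eB]; exists (const_mx (e / 2)); split.
  split; first by move=> j l; rewrite !mxE.
  by rewrite /= mxE gt_eqF // divr_gt0.
apply: eB; split=> // j l; rewrite !mxE /ball /= sub0r normrN.
by rewrite gtr0_norm ?divr_gt0 // ltr_pdivrMr // ltr_pMr // ltr1n.
Qed.

Theorem theorem7p8 (R : realType) (n r k d : nat)
    (hn : (1 <= n)%N) (hr : (1 <= r)%N) (hk : (1 <= k <= n)%N)
    (hd : (1 <= d)%N)
    (a : R[i]) (zeta : 'I_n -> R[i])
    (hzeta : forall j, zeta j ^+ r = 1)
    (hzeta1 : forall j : 'I_n, nat_of_ord j = 0%N -> zeta j = 1)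
    (x0 : 'rV[R[i]]_n) (hx0 : x0 = \row_j (zeta j * a))
    (i : 'I_n) :
  let D : 'rV[R[i]]_n -> R[i] := pderiven i d (U r k) in
  let T : set 'rV[R[i]]_n := Tset n r in
  [/\ (d < k)%N -> D x0 = 0,
      d = k ->
        [/\ D x0 = r%:R ^+ k * x0 0 i ^+ (k * (r - 1)) * gamma_coef k n,
            (2 <= r)%N -> D 0 = 0
          & forall x, T x -> x != 0 -> x 0 i != 0 /\ D x != 0]
    & (k < d)%N ->
        [/\ (d < k * r)%N ->
              [/\ D x0 = (kappa r d k)%:~R * x0 0 i ^+ (k * r - d) * gamma_coef k n,
                  D 0 = 0
                & generically_nonzero T D],
            d = (k * r)%N ->
              D x0 = (kappa r (k * r) k)%:~R * gamma_coef k n /\ D 0 != 0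
          & (k * r < d)%N -> kappa r d k = 0 /\ D x0 = 0]].
Proof.
move=> D T.
have [k0 kn] := andP hk.
have DT x : T x ->
    D x = (kappa r d k)%:~R * x 0 i ^+ (k * r - d) * gamma_coef k n.
  exact: pderiven_U.
have Tx0 : T x0 by move=> j l; rewrite hx0 !mxE !exprMn !hzeta.
have T0 : T 0 by move=> j l; rewrite !mxE.
have kappa_neq0 : (k <= d <= k * r)%N -> (kappa r d k)%:~R != 0 :> R[i].
  by move=> kd; rewrite intr_eq0 gt_eqF // kappa_gt0.
have gamma_neq0 : gamma_coef k n != 0 :> R[i] by exact: gamma_coef_neq0.
split=> [dk|dk|kd].
- by rewrite DT // kappa_out ?mul0r //; lia.
- split=> [|r2|x Tx x_neq0].
  + by rewrite DT // dk kappa_diag // -natrX mulnBr muln1.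
  + have dkr : (d < k * r)%N by nia.
    by rewrite DT // mxE expr0n subn_eq0 leqNgt dkr mulr0 mul0r.
  + have xi := Tset_coord_neq0 i hr Tx x_neq0; split => //.
    rewrite DT // mulf_neq0 // mulf_neq0 ?expf_neq0 // kappa_neq0 //; nia.
- split=> [dkr|dkr|krd].
  + split; first by rewrite DT.
      by rewrite DT // mxE expr0n subn_eq0 leqNgt dkr mulr0 mul0r.
    exists [set x | x 0 i != 0]; split; last 2 first.
    * exact: Tset_sub_closure.
    * move=> x [Tx /= xi]; rewrite DT // mulf_neq0 // mulf_neq0 ?expf_neq0 //.
      by rewrite kappa_neq0 // (ltnW kd) (ltnW dkr).
    exact: open_coord_neq0.
  (* The exponent is 0, so the power of x_i is 1 even at the origin. *)
  + rewrite !DT // -dkr subnn !expr0 mulr1; split => //.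
    by rewrite mulf_neq0 // kappa_neq0 // -dkr leqnn (ltnW kd).
  + by rewrite DT // kappa_small // !mul0r.
Qed.
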